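(* Let $G$ be a finite graph with $n$ nodes, ordered as $v_1, v_2, \ldots, v_n$. Let $M_G$ be the set of maximal tubings of $G$, i.e. tubings consisting of $n-1$ tubes. For each $U \in M_G$ define $f_U$ from the nodes of $G$ to the integers as follows: if $\{v\}$ is a tube of $U$, then $f_U(v) = 0$; otherwise, letting $t(v)$ denote the smallest tube of $U$ containing $v$ (taken to be the full node set of $G$ if no tube of $U$ contains $v$), $f_U$ satisfies $$\sum_{x \in t(v)} f_U(x) = 3^{|t(v)| - 2}.$$ Define $c(U) = (f_U(v_1), f_U(v_2), \ldots, f_U(v_n)) \in \mathbb{R}^n$. Then the convex hull of the points $\{c(U) : U \in M_G\}$ in $\mathbb{R}^n$ is a realization of the graph-associahedron $\mathcal{P}G$: it is a simple convex polytope whose face poset is isomorphic to the poset of tubings of $G$, ordered so that $U \prec U'$ if $U$ is obtained from $U'$ by adding tubes.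
   Context: Let $G$ be a finite graph. A tube is a proper nonempty set of nodes of $G$ whose induced subgraph is a proper, connected subgraph of $G$. Two tubes $u_1, u_2$ are nested if $u_1 \subset u_2$ (or vice versa); they intersect if $u_1 \cap u_2 \neq \emptyset$ and neither contains the other; they are adjacent if $u_1 \cap u_2 = \emptyset$ and $u_1 \cup u_2$ is a tube of $G$. Two tubes are compatible if they neither intersect nor are adjacent. A tubing of $G$ is a set of tubes of $G$ any two of which are compatible (the empty set is a tubing). If $G$ is disconnected with connected components $G_1, \ldots, G_k$ and $u_i$ is the tube whose induced graph is $G_i$, then a tubing is additionally required not to contain all of $u_1, \ldots, u_k$. Consequently a tubing of a graph with $n$ nodes has at most $n-1$ tubes. The graph-associahedron $\mathcal{P}G$ is the simple convex polytope whose face poset is isomorphic to the set of tubings of $G$ ordered by $U \prec U'$ if $U$ is obtained from $U'$ by adding tubes (so maximal tubings correspond to vertices and the empty tubing to the whole polytope).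
   Formalization: Disjoint tubes are also adjacent when their union is the whole node set of a connected graph (otherwise K_2 would have a tubing with 2 > n-1 tubes and the claim fails); for n = 1 the exponent |t(v)|-2 is taken to be 0, since no integer equals 3^{-1}. *)

(* Defs.v *)
From HB Require Import structures.
From mathcomp Require Import all_boot all_order all_algebra.

Set Implicit Arguments.
Unset Strict Implicit.
Unset Printing Implicit Defensive.

Import Order.TTheory GRing.Theory Num.Theory.
Local Open Scope ring_scope.

(* A finite graph is a symmetric relation adj
   on a finType V. Loops are harmless: only connectedness of induced subgraphs
   matters. *)

Section GraphTubings.
Variables (V : finType) (adj : rel V).
Implicit Types (u A : {set V}) (U : {set {set V}}).

Definition induced A : rel V := [rel x y | [&& x \in A, y \in A & adj x y]].

(* Vacuously true of the empty set, which tube excludes separately. *)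
Definition connected_set A : bool :=
  [forall x in A, forall y in A, connect (induced A) x y].

Definition tube u : bool := [&& u != set0, u != setT & connected_set u].

Definition intersecting u1 u2 : bool :=
  [&& u1 :&: u2 != set0, ~~ (u1 \subset u2) & ~~ (u2 \subset u1)].

(* "The union is a tube" is read as "the union induces a connected subgraph",
   without properness: when G is connected, two disjoint tubes covering all
   the nodes are adjacent. Otherwise {{1}, {2}} would be a tubing of the
   one-edge graph, with 2 > n - 1 tubes. *)
Definition adjacent u1 u2 : bool :=
  (u1 :&: u2 == set0) && connected_set (u1 :|: u2).

Definition compatible u1 u2 : bool :=
  ~~ intersecting u1 u2 && ~~ adjacent u1 u2.

Definition components : {set {set V}} :=
  equivalence_partition (connect adj) [set: V].

Definition tubing U : bool :=
  [&& [forall u in U, tube u],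
      [forall u1 in U, forall u2 in U, compatible u1 u2]
    & ~~ connected_set [set: V] ==> ~~ (components \subset U)].

Definition maximal_tubings : {set {set {set V}}} :=
  [set U | tubing U & #|U| == #|V|.-1].

(* The tubes of a tubing that contain x form a chain, so the one with fewest
   nodes is the smallest one; tubes being proper, [set: V] is selected only
   when no tube of U contains x. *)
Definition smallest_tube U (x : V) : {set V} :=
  [arg min_(u < [set: V] | (u \in [set: V] |: U) && (x \in u)) #|u|]%N.

(* If #|V| > 1, the exponent is a genuine difference: outside the first case
   the smallest tube has at least two nodes. If #|V| = 1, where no integer
   solves the equation with right-hand side 3^-1, the truncated exponent 0 is
   the convention. *)
Definition is_node_weight U (f : {ffun V -> int}) : Prop :=
  forall x : V,
    if [set x] \in U then f x = 0
    else \sum_(y in smallest_tube U x) f y = 3 ^+ (#|smallest_tube U x| - 2).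

End GraphTubings.

Definition weight_point (R : pzRingType) (V : finType) (n : nat) (v : 'I_n -> V)
    (f : {ffun V -> int}) : 'rV[R]_n :=
  \row_(i < n) (f (v i))%:~R.

From mathcomp Require Import boolp classical_sets functions cardinality.
From mathcomp Require Import reals convex.
Local Open Scope classical_set_scope.
Local Open Scope card_scope.

Section Polytopes.
Variables (R : realType) (n : nat).
Implicit Types (S P F : set 'rV[R]_n) (w : 'rV[R]_n).

Definition convex_hull S : set 'rV[R]_n :=
  smallest (@convex_set R 'rV[R]_n) S.

Definition polytope P : Prop :=
  exists2 S : set 'rV[R]_n, finite_set S & P = convex_hull S.

Definition affinely_independent k (p : 'I_k.+1 -> 'rV[R]_n) : bool :=
  row_free (\matrix_(i < k) (p (lift ord0 i) - p ord0)).

(* The affine hull of S has dimension d; no d qualifies for the empty set. *)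
Definition has_dim S (d : nat) : Prop :=
  (exists p : 'I_d.+1 -> 'rV[R]_n,
     (forall i, S (p i)) /\ affinely_independent p) /\
  (forall k (p : 'I_k.+1 -> 'rV[R]_n),
     (forall i, S (p i)) -> affinely_independent p -> (k <= d)%N).

(* P itself (a = 0, b = 0) and the empty set (a = 0, b = 1) are faces. *)
Definition face P F : Prop :=
  exists (a : 'rV[R]_n) (b : R),
    (forall x, P x -> \sum_i a 0 i * x 0 i <= b) /\
    F = [set x | P x /\ \sum_i a 0 i * x 0 i = b].

Definition nonempty_face P F : Prop := face P F /\ F !=set0.

Definition facet P F : Prop :=
  face P F /\ exists k, has_dim F k /\ has_dim P k.+1.

Definition vertex P w : Prop := face P [set w].

Definition simple_polytope P : Prop :=
  polytope P /\
  exists d, has_dim P d /\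
    forall w, vertex P w -> [set F | facet P F /\ F w] #= `I_d.

(* Tubings are ordered by reverse inclusion, faces by inclusion. The empty
   face is left out of the face poset: the maximal tubings are its minimal
   elements. *)
Definition realizes_graph_associahedron (V : finType) (adj : rel V) P : Prop :=
  simple_polytope P /\
  exists phi : {set {set V}} -> set 'rV[R]_n,
    [/\ forall U, tubing adj U -> nonempty_face P (phi U),
        forall F, nonempty_face P F -> exists2 U, tubing adj U & phi U = F
      & forall U U', tubing adj U -> tubing adj U' ->
          phi U `<=` phi U' <-> U' \subset U].

End Polytopes.

(* Main.v *)
(**
Put g(u) = 0 for singletons u and g(u) = 3 ^ (|u| - 2) for larger sets, and
write x(u) for the sum of the coordinates of x over u. In a maximal tubing U
the map sending a node to its smallest tube is a bijection onto U and the full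
set, and superadditivity of g gives f_U(x) > g(|t(x)| - 1) whenever
|t(x)| > 1. A tube u outside U contains a node x with u strictly inside t(x);
hence c(U)(u) >= g(u) for every tube u, with equality exactly when u is in U.

The face lattice is read off these inequalities. Every function on the nodes
is a constant plus a positive combination of indicators of the tubes of some
tubing T, so the corresponding linear functional is minimal on the hull exactly
where x(u) = g(u) for all u in T. Distinct tubings give distinct faces, and
faces have the expected dimension, because for a tubing T and a tube u not in T
some maximal tubing contains T and avoids u.
*)

Require Import Defs.
From mathcomp Require Import all_boot all_order all_algebra.
From mathcomp Require Import zify.

Set Implicit Arguments.
Unset Strict Implicit.
Unset Printing Implicit Defensive.

(** * Connectivity and components of induced subgraphs *)

Section Tubings.
Variables (V : finType) (adj : rel V) (adj_sym : symmetric adj).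
Implicit Types (A B S u w : {set V}) (T U : {set {set V}}) (x y z : V).

Let connected := connected_set adj.

Lemma connect_induced_sym A : connect_sym (induced adj A).
Proof.
by apply: sym_connect_sym => x y; rewrite /induced /= adj_sym andbCA.
Qed.

Lemma connectedP A :
  reflect {in A &, forall x y, connect (induced adj A) x y} (connected A).
Proof.
apply: (iffP forall_inP) => [cA x y xA yA|cA x xA].
  by move/forall_inP: (cA x xA); apply.
by apply/forall_inP => y yA; apply: cA.
Qed.

Lemma connect_induced_sub A B : A \subset B ->
  subrel (connect (induced adj A)) (connect (induced adj B)).
Proof.
move=> sAB; apply: connect_sub => x y /and3P[xA yA xy].
by apply: connect1; rewrite /induced /= !(subsetP sAB) ?xy.
Qed.

Lemma connected_from A x :
  (forall y, y \in A -> connect (induced adj A) x y) -> connected A.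
Proof.
move=> cA; apply/connectedP => y z /cA xy /cA; apply: connect_trans.
by rewrite connect_induced_sym.
Qed.

Lemma connected_closed A B x : connected A -> x \in A -> x \in B ->
  (forall y z, y \in A -> y \in B -> z \in A -> adj y z -> z \in B) ->
  A \subset B.
Proof.
move=> /connectedP cA xA xB clB; apply/subsetP => y yA.
have clAB : closed (induced adj A) (mem B).
  apply: (intro_closed (connect_induced_sym A)) => s t /and3P[sA tA st] sB.
  exact: clB st.
by rewrite -(closed_connect clAB (cA x y xA yA)).
Qed.

Lemma connected_unionl A B y z : connected A -> connected B ->
  y \in A -> z \in B -> (y == z) || adj y z -> connected (A :|: B).
Proof.
move=> /connectedP cA /connectedP cB yA zB yz.
have czt t : t \in B -> connect (induced adj (A :|: B)) z t.
  by move=> tB; apply: (connect_induced_sub (subsetUr A B)); exact: cB.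
apply: (@connected_from _ y) => t /setUP[tA|tB].
  by apply: (connect_induced_sub (subsetUl A B)); exact: cA.
apply: connect_trans (czt t tB); case/orP: yz => [/eqP->//|yz].
by apply: connect1; rewrite /induced /= !inE yA zB yz orbT.
Qed.

(** No membership of [x] in [S] is required: for [x] outside [S] this is the singleton of [x]. *)
Definition component S x : {set V} := [set z | connect (induced adj S) x z].

Lemma mem_component S x : x \in component S x.
Proof. by rewrite inE. Qed.

Lemma component_sub S x : x \in S -> component S x \subset S.
Proof.
move=> xS; apply/subsetP => y; rewrite inE => /connectP[p].
elim/last_ind: p => [_ -> //|p z _].
by rewrite rcons_path last_rcons => /andP[_ /and3P[_ zS _]] ->.
Qed.

Lemma connected_component S x : connected (component S x).
Proof.
apply: (@connected_from _ x) => y; rewrite inE => /connectP[p + ->].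
elim/last_ind: p => [//|p z IH]; rewrite rcons_path last_rcons => /andP[xp pz].
apply: connect_trans (IH xp) _; apply: connect1.
have xl : connect (induced adj S) x (last x p) by apply/connectP; exists p.
rewrite /induced /= !inE xl (connect_trans xl (connect1 pz)).
by case/and3P: pz.
Qed.

Lemma connected_sub_component A S x z : connected A -> A \subset S ->
  z \in A -> z \in component S x -> A \subset component S x.
Proof.
move=> /connectedP cA sAS zA; rewrite inE => xz; apply/subsetP => y yA.
rewrite inE; apply: connect_trans xz _.
by apply: (connect_induced_sub sAS); exact: cA.
Qed.

(** * Compatible tubes and tubings *)

Lemma compatible_sym u w : compatible adj u w = compatible adj w u.
Proof.
rewrite /compatible /intersecting /adjacent (setIC w) (setUC w).
by rewrite (andbC (~~ (w \subset u))).
Qed.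

(** Sets that share a node or are joined by an edge have a connected union, so if disjoint they are
    adjacent, and if they overlap only nesting keeps them from intersecting. The disjunction treats
    both situations at once. *)
Lemma compatible_nested u w y z : connected u -> connected w ->
  compatible adj u w -> y \in u -> z \in w -> (y == z) || adj y z ->
  (u \subset w) || (w \subset u).
Proof.
move=> cu cw /andP[+ +] yu zw yz; rewrite /intersecting /adjacent.
rewrite -/connected (connected_unionl cu cw yu zw yz) andbT => /[swap] ->.
by rewrite /= negb_and !negbK.
Qed.

(** The component absorbs every connected subset of [S] that meets it; if [w] were adjacent to it,
    the union would be absorbed as well, leaving [w] empty. *)
Lemma compatible_component S x w : x \in S -> connected w -> w \subset S ->
  w != set0 -> compatible adj (component S x) w.
Proof.
move=> xS cw wS w0; have cS := component_sub xS.
apply/andP; split; apply/negP.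
  case/and3P => /set0Pn[z /setIP[zx zw]] _ /negP; apply.
  exact: connected_sub_component zx.
case/andP => /eqP di cu; case/negP: w0; rewrite -subset0 -di subsetI subxx andbT.
apply: subset_trans (subsetUr (component S x) w) _.
apply: (@connected_sub_component _ _ _ x) => //; last exact: mem_component.
  by rewrite subUset cS.
by rewrite inE mem_component.
Qed.

Lemma tubing_tube T u : tubing adj T -> u \in T -> tube adj u.
Proof. by case/and3P => /forall_inP tT _ _ /tT. Qed.

Lemma tubing_compatible T u w :
  tubing adj T -> u \in T -> w \in T -> compatible adj u w.
Proof. by case/and3P => _ /forall_inP cT _ /cT/forall_inP/[apply]. Qed.

Lemma tubing_nested T u w y z : tubing adj T -> u \in T -> w \in T ->
  y \in u -> z \in w -> (y == z) || adj y z -> (u \subset w) || (w \subset u).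
Proof.
move=> tT uT wT; apply: compatible_nested; last exact: tubing_compatible tT _ _.
  by case/and3P: (tubing_tube tT uT).
by case/and3P: (tubing_tube tT wT).
Qed.

Lemma components_mem x : component setT x \in components adj.
Proof.
apply/imsetP; exists x => //; apply/setP => y; rewrite !inE /=.
by apply: eq_connect => s t; rewrite /induced /= !inE.
Qed.

Lemma components_component u :
  u \in components adj -> exists2 x, x \in u & u = component setT x.
Proof.
case/imsetP => x _ ->; exists x; first by rewrite !inE connect0.
apply/setP => y; rewrite !inE /=.
by apply: eq_connect => s t; rewrite /induced /= !inE.
Qed.

(** The component of a node [z] missed by all tubes cannot belong to [T], which settles the
    condition on components. *)
Lemma tubingI T z : {in T, forall u, tube adj u} ->
  {in T &, forall u w, compatible adj u w} -> {in T, forall u, z \notin u} ->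
  tubing adj T.
Proof.
move=> tT cT zT; apply/and3P; split; first exact/forall_inP.
  by apply/forall_inP => u uT; apply/forall_inP => w; exact: cT.
apply/implyP => _; apply/negP => /subsetP /(_ _ (components_mem z)) /zT.
by rewrite mem_component.
Qed.

(** * Depth of nodes and smallest tubes *)

Definition depth T x := #|[set w in T | x \in w]|.

Lemma mem_smallest_tube T x : x \in smallest_tube T x.
Proof.
by rewrite /smallest_tube; case: arg_minnP => [|u /andP[]]; rewrite ?in_setU1 ?inE ?eqxx.
Qed.

Lemma smallest_tube_in T x : smallest_tube T x \in setT |: T.
Proof.
by rewrite /smallest_tube; case: arg_minnP => [|u /andP[]]; rewrite ?in_setU1 ?inE ?eqxx.
Qed.

Lemma smallest_tube_sub T u x : tubing adj T -> u \in setT |: T -> x \in u ->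
  smallest_tube T x \subset u.
Proof.
move=> tT /setU1P[->|uT] xu; first exact: subsetT.
have := mem_smallest_tube T x; have := smallest_tube_in T x.
have : #|smallest_tube T x| <= #|u|.
  rewrite /smallest_tube; case: arg_minnP => [|w _ ->//].
    by rewrite in_setU1 !inE eqxx.
  by rewrite in_setU1 uT orbT.
move: (smallest_tube _ _) => t le_t /setU1P[t1|tT'] xt.
  rewrite t1 cardsT in le_t; rewrite t1 subTset eqEcard subsetT cardsT.
  exact: le_t.
have /orP[//|ut] : (t \subset u) || (u \subset t).
  by apply: (tubing_nested tT tT' uT xt xu); rewrite eqxx.
by rewrite (_ : t = u) //; apply/eqP; rewrite eq_sym eqEcard ut.
Qed.

Lemma depth_smallest_tube T x y : tubing adj T -> y \in smallest_tube T x ->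
  depth T x <= depth T y.
Proof.
move=> tT yt; apply/subset_leq_card/subsetP => w; rewrite !inE => /andP[wT xw].
rewrite wT; apply: (subsetP (smallest_tube_sub tT _ xw)) yt.
by rewrite in_setU1 wT orbT.
Qed.

(* Some tube containing z omits x, hence crosses the smallest tube of x or is
   adjacent to it through the edge y z. *)
Lemma smallest_tube_closed T x y z : tubing adj T ->
  y \in smallest_tube T x -> adj y z -> depth T x <= depth T z ->
  z \in smallest_tube T x.
Proof.
move=> tT yt yz; apply: contraLR => zt; rewrite -ltnNge; apply: proper_card.
have /setU1P[t1|tin] := smallest_tube_in T x; first by rewrite t1 in_setT in zt.
have sub_t w : w \in T -> x \in w -> smallest_tube T x \subset w.
  by move=> wT; apply: smallest_tube_sub => //; rewrite in_setU1 wT orbT.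
have noT w : w \in T -> z \in w -> x \in w.
  move=> wT zw; have yz' : (y == z) || adj y z by rewrite yz orbT.
  case/orP: (tubing_nested tT tin wT yt zw yz') => [/subsetP|/subsetP/(_ _ zw)].
    by apply; exact: mem_smallest_tube.
  by rewrite (negPf zt).
apply/properP; split.
  by apply/subsetP => w; rewrite !inE => /andP[wT /(noT _ wT)->]; rewrite wT.
exists (smallest_tube T x); first by rewrite inE tin mem_smallest_tube.
by rewrite inE (negPf zt) andbF.
Qed.

(** An edge leaving the smallest tube of [x] leads to a node of smaller depth, so a connected set
    with least depth at [x] cannot leave that tube. *)
Lemma sub_smallest_tube T A x : tubing adj T -> connected A -> x \in A ->
  {in A, forall z, depth T x <= depth T z} -> A \subset smallest_tube T x.
Proof.
move=> tT cA xA minx; apply: (connected_closed cA xA (mem_smallest_tube T x)).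
by move=> y z yA yt zA yz; apply: smallest_tube_closed yt yz (minx z zA).
Qed.

Lemma smallest_tubes_nested T x y z : tubing adj T ->
  z \in smallest_tube T x -> z \in smallest_tube T y ->
  (smallest_tube T x \subset smallest_tube T y)
  || (smallest_tube T y \subset smallest_tube T x).
Proof.
move=> tT; have /setU1P[->|xT] := smallest_tube_in T x; first by rewrite subsetT orbT.
have /setU1P[->|yT] := smallest_tube_in T y; first by rewrite subsetT.
by move=> zx zy; apply: (tubing_nested tT xT yT zx zy); rewrite eqxx.
Qed.

Lemma setT_notin_tubing T : tubing adj T -> setT \notin T.
Proof.
by move=> tT; apply/negP => /(tubing_tube tT)/and3P[_]; rewrite eqxx.
Qed.

Lemma smallest_tube_setT T u z : tubing adj T -> smallest_tube T z = setT ->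
  u \in T -> z \notin u.
Proof.
move=> tT z1 uT; apply: contraL uT => zu; apply/negP => uT.
have : smallest_tube T z \subset u.
  by apply: smallest_tube_sub => //; rewrite in_setU1 uT orbT.
rewrite z1 subTset => /eqP u1.
by rewrite u1 (negPf (setT_notin_tubing tT)) in uT.
Qed.

(* Otherwise each component K of the graph would lie in T: it is the smallest tube of any
   node of least depth in K. *)
Lemma tubing_uncovered T x0 : tubing adj T -> exists x, smallest_tube T x = setT.
Proof.
move=> tT; case: (pickP (fun x => smallest_tube T x == setT)) => [x /eqP|cov].
  by exists x.
have inT x : component setT x \in T.
  set K := component _ x; have xK : x \in K by exact: mem_component.
  case: (arg_minnP (depth T) xK) => y yK min_y.
  have /setU1P[t1|tin] := smallest_tube_in T y.
    by move: (cov y); rewrite t1 eqxx.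
  suff -> : K = smallest_tube T y by [].
  apply/eqP; rewrite eqEsubset; apply/andP; split.
    exact: sub_smallest_tube (connected_component _ _) yK min_y.
  have /and3P[_ _ ct] := tubing_tube tT tin.
  apply: connected_sub_component ct (subsetT _) _ yK.
  exact: mem_smallest_tube.
have /and3P[_ _] := tT; case: (boolP (connected_set _ _)) => [c1 _|_ /=].
  have : setT \subset component setT x0.
    by apply: (@connected_sub_component _ _ _ x0) => //; exact: mem_component.
  by rewrite subTset => /eqP K1; have := inT x0; rewrite K1 (negPf (setT_notin_tubing tT)).
case/negP; apply/subsetP => u /components_component[x _ ->]; exact: inT.
Qed.

(** A tube is the smallest tube of any of its nodes of least depth; the full set is that of an
    uncovered node. *)
Lemma smallest_tube_onto T t x0 : tubing adj T -> t \in setT |: T ->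
  exists x, smallest_tube T x = t.
Proof.
move=> tT /setU1P[->|tin]; first exact: tubing_uncovered.
have /and3P[/set0Pn[y yt] _ ct] := tubing_tube tT tin.
case: (arg_minnP (depth T) yt) => x xt min_x; exists x; apply/eqP.
rewrite eqEsubset smallest_tube_sub // ?in_setU1 ?tin ?orbT //=.
exact: sub_smallest_tube min_x.
Qed.

(** * Counting the tubes of a tubing *)

Lemma setT_tubing_sub_imset T x0 : tubing adj T ->
  setT |: T \subset [set smallest_tube T x | x in V].
Proof.
move=> tT; apply/subsetP => t /(smallest_tube_onto x0 tT)[x <-].
exact: imset_f.
Qed.

Lemma card_tubing T : tubing adj T -> #|T| <= #|V|.-1.
Proof.
move=> tT; case: (pickP (predT : pred V)) => [x0 _|V0].
  have := leq_trans (subset_leq_card (setT_tubing_sub_imset x0 tT)) (leq_imset_card _ _).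
  by rewrite cardsU1 setT_notin_tubing //=; case: #|V|.
rewrite (_ : T = set0) ?cards0 //; apply/setP => u; rewrite inE.
apply/negP => /(tubing_tube tT)/and3P[/set0Pn[x]].
by have := V0 x.
Qed.

Lemma maximal_tubing U : U \in maximal_tubings adj -> tubing adj U.
Proof. by rewrite inE => /andP[]. Qed.

Lemma card_maximal U : U \in maximal_tubings adj -> #|U| = #|V|.-1.
Proof. by rewrite inE => /andP[_ /eqP]. Qed.

(** The nodes map onto [setT |: U], which has as many elements as there are nodes. *)
Lemma smallest_tube_inj U : U \in maximal_tubings adj ->
  injective (smallest_tube U).
Proof.
move=> mU x y; have tU := maximal_tubing mU.
suff /imset_injP inj : #|[set smallest_tube U z | z in V]| == #|V|.
  exact: inj.
rewrite eqn_leq leq_imset_card (leq_trans _ (subset_leq_card (setT_tubing_sub_imset x tU))) //.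
rewrite cardsU1 setT_notin_tubing // (card_maximal mU) add1n prednK //.
by apply/card_gt0P; exists x.
Qed.

(** * Tubings from superlevel sets of a function on the nodes *)

Section Superlevel.
Variable a : V -> nat.

Definition superlevel_component x := component [set z | a x <= a z] x.

(** Nodes where [a] is minimal are left out: their superlevel set is the whole graph, whose
    components must not all be taken. *)
Definition superlevel_tubing :=
  [set superlevel_component x | x in [set x | [exists y, a y < a x]]].

Lemma superlevel_component_ge x z : z \in superlevel_component x -> a x <= a z.
Proof.
have xS : x \in [set z | a x <= a z] by rewrite inE.
by move/(subsetP (component_sub xS)); rewrite inE.
Qed.

(** Superlevel sets form a chain, so of two chosen components one is a component of a set containing
    the other. A minimizer of [a] lies in no tube. *)
Lemma superlevel_tubing_tubing x0 : tubing adj superlevel_tubing.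
Proof.
have comp_le x y : a x <= a y ->
    compatible adj (superlevel_component x) (superlevel_component y).
  move=> le_xy; apply: compatible_component; rewrite ?inE //.
  - exact: connected_component.
  - apply/subsetP => z /superlevel_component_ge; rewrite inE.
    exact: leq_trans.
  - by apply/set0Pn; exists y; exact: mem_component.
case: (arg_minnP a (isT : predT x0)) => m _ min_m.
apply: (@tubingI _ m).
- move=> _ /imsetP[x /[!inE] /existsP[y yx] ->]; apply/and3P; split.
  + by apply/set0Pn; exists x; exact: mem_component.
  + apply/negP => /eqP x1; have : y \in superlevel_component x by rewrite x1.
    by move/superlevel_component_ge; rewrite leqNgt yx.
  + exact: connected_component.
- move=> _ _ /imsetP[x _ ->] /imsetP[y _ ->].
  by case/orP: (leq_total (a x) (a y)) => /comp_le //; rewrite compatible_sym.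
- move=> _ /imsetP[x /[!inE] /existsP[y yx] ->]; apply/negP.
  by move/superlevel_component_ge; rewrite leqNgt (leq_ltn_trans (min_m y isT) yx).
Qed.

(** Each component determines [x] as the point where [a] is least on it, so the nodes other than the
    minimizer give distinct tubes. *)
Lemma superlevel_tubing_maximal x0 : injective a ->
  superlevel_tubing \in maximal_tubings adj.
Proof.
move=> inj_a; rewrite inE superlevel_tubing_tubing //=.
case: (arg_minnP a (isT : predT x0)) => m _ min_m.
rewrite card_imset => [|x y eq_xy].
  rewrite (_ : [set x | _] = [set~ m]) ?cardsC1 //.
  apply/setP => x; rewrite !inE; apply/existsP/idP => [[y yx]|xm].
    by apply: contraL yx => /eqP->; rewrite -leqNgt min_m.
  exists m; rewrite ltn_neqAle min_m // andbT.
  by apply: contra xm => /eqP/inj_a->.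
have xy : x \in superlevel_component y by rewrite -eq_xy mem_component.
have yx : y \in superlevel_component x by rewrite eq_xy mem_component.
by apply/inj_a/eqP; rewrite eqn_leq !superlevel_component_ge.
Qed.

Hypothesis (T : {set {set V}}) (tT : tubing adj T).
Hypothesis a_depth : forall x y, a x <= a y -> depth T x <= depth T y.

Lemma superlevel_component_sub x : superlevel_component x \subset smallest_tube T x.
Proof.
apply: sub_smallest_tube => //; [exact: connected_component|exact: mem_component|].
by move=> z /superlevel_component_ge/a_depth.
Qed.

(** A tube [u] of [T] is the component at the minimizer [x] of [a] on [u]: it is connected and lies
    in the superlevel set, while that component lies in the smallest tube of [x], hence in [u]. *)
Lemma sub_superlevel_tubing : T \subset superlevel_tubing.
Proof.
apply/subsetP => u uT; have /and3P[/set0Pn[y yu] u1 cu] := tubing_tube tT uT.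
case: (arg_minnP a yu) => x xu min_x.
have [z tz] := tubing_uncovered x tT.
have tx : smallest_tube T x \subset u.
  by apply: smallest_tube_sub => //; rewrite in_setU1 uT orbT.
apply/imsetP; exists x.
  (* The uncovered node [z] has depth 0 and [x] has positive depth, so [x] is not a minimizer of
     [a]. *)
  rewrite inE; apply/existsP; exists z; rewrite ltnNge; apply: contra u1.
  move/a_depth => xz; exfalso; have : 0 < depth T x.
    by apply/card_gt0P; exists u; rewrite inE uT.
  rewrite ltnNge (leq_trans xz) // leqn0 cards_eq0 -subset0.
  apply/subsetP => w; rewrite !inE => /andP[wT].
  by rewrite (negPf (smallest_tube_setT tT tz wT)).
apply/eqP; rewrite eqEsubset (subset_trans (superlevel_component_sub x) tx) andbT.
apply: (@connected_sub_component _ _ _ x) => //; last exact: mem_component.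
by apply/subsetP => t tu; rewrite inE min_x.
Qed.

End Superlevel.

(* Use the superlevel sets of an injective function ordering the nodes by depth
   in T, then by membership in u (nodes of u first). *)
Lemma tubing_extend_avoid T u : tubing adj T -> u \notin setT |: T ->
  exists U, [/\ U \in maximal_tubings adj, T \subset U & u \notin U].
Proof.
move=> tT; rewrite in_setU1 negb_or => /andP[u1 uT].
have [x0 _|V0] := pickP (predT : pred V); last first.
  by case/eqP: u1; apply/setP => x; have := V0 x.
(* The factor 2 lets depth outrank the membership bit; in [a] the last digit in base [#|V|] breaks
   ties. *)
pose b x := 2 * depth T x + (x \notin u).
pose a x := b x * #|V| + enum_rank x.
have V_gt0 : 0 < #|V| by apply/card_gt0P; exists x0.
have a_b x y : a x <= a y -> b x <= b y.
  move/(leq_div2r #|V|); rewrite /a !divnMDl // !divn_small ?addn0 //;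
  exact: ltn_ord.
have a_inj : injective a.
  move=> x y /(congr1 (modn^~ #|V|)); rewrite /a !modnMDl !modn_small ?ltn_ord //.
  by move/ord_inj/enum_rank_inj.
have a_depth x y : a x <= a y -> depth T x <= depth T y.
  by move/a_b; rewrite /b; case: (_ \notin _); case: (_ \notin _); lia.
exists (superlevel_tubing a); split.
- exact: superlevel_tubing_maximal.
- exact: sub_superlevel_tubing.
apply/imsetP => -[x /[!inE] /existsP[y yx] u_def].
have ut : u \subset smallest_tube T x by rewrite u_def superlevel_component_sub.
have xu : x \in u by rewrite u_def mem_component.
(* If [u] were the component at [x], the smallest tube of [x] would lie in its superlevel set: nodes
   outside [u] come after [x] by the membership bit. Being connected, that tube would equal [u]. *)
have t_ge z : z \in smallest_tube T x -> a x <= a z.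
  move=> zt; have [zu|zu] := boolP (z \in u).
    by apply: superlevel_component_ge; rewrite -u_def.
  have le_xz := depth_smallest_tube tT zt.
  by rewrite leqNgt; apply/negP => /ltnW/a_b; rewrite /b zu xu /=; lia.
have /setU1P[t1|tin] := smallest_tube_in T x.
  by have := t_ge y; rewrite t1 in_setT leqNgt yx => /(_ isT).
have /and3P[_ _ ct] := tubing_tube tT tin.
suff tu : smallest_tube T x \subset u.
  by case/negP: uT; rewrite (_ : u = smallest_tube T x) //; apply/eqP; rewrite eqEsubset ut.
rewrite [in X in _ \subset X]u_def; apply: connected_sub_component ct _ (mem_smallest_tube _ _) (mem_component _ _).
by apply/subsetP => z /t_ge; rewrite inE.
Qed.

Lemma tubing_extend T : tubing adj T ->
  exists2 U, U \in maximal_tubings adj & T \subset U.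
Proof.
move=> tT; have [x0 _|V0] := pickP (predT : pred V); last first.
  exists T => //; rewrite inE tT eqn_leq card_tubing //.
  by rewrite (_ : #|V| = 0) //; apply: eq_card0 => x; have := V0 x.
(* The empty set serves as the set to avoid, since it is never a tube. *)
have [|U [mU TU _]] := @tubing_extend_avoid T set0 tT; last by exists U.
rewrite in_setU1 negb_or; apply/andP; split.
  by apply/eqP => /setP/(_ x0); rewrite !inE.
by apply/negP => /(tubing_tube tT)/and3P[]; rewrite eqxx.
Qed.

(** * Node weights and their sums over tubes *)

Section NodeWeights.
Import GRing.Theory Num.Theory Order.TTheory.
Local Open Scope ring_scope.

Lemma sum_setD1 (M : nmodType) (F : V -> M) A x : x \in A ->
  \sum_(y in A) F y = F x + \sum_(y in A :\ x) F y.
Proof. by move=> xA; rewrite (big_setD1 x xA). Qed.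

Variables (U : {set {set V}}) (mU : U \in maximal_tubings adj).
Implicit Types f : {ffun V -> int}.

Let tU : tubing adj U := maximal_tubing mU.
Local Notation st := (smallest_tube U).

Lemma smallest_tube_proper x y : y \in st x -> y != x ->
  st y \subset st x :\ x.
Proof.
move=> yt neq_yx; have st_in z : st z \in setT |: U by exact: smallest_tube_in.
apply/subsetP => z zt; rewrite in_setD1.
have tyx : st y \subset st x by exact: smallest_tube_sub (st_in x) yt.
rewrite (subsetP tyx) // andbT; apply: contra neq_yx => /eqP zx.
apply/eqP/(smallest_tube_inj mU)/eqP; rewrite eqEsubset tyx /=.
by apply: smallest_tube_sub (st_in y) _ => //; rewrite -zx.
Qed.

Lemma card_smallest_tube_lt x y : y \in st x -> y != x -> (#|st y| < #|st x|)%N.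
Proof.
move=> yt neq_yx; apply: leq_ltn_trans (subset_leq_card (smallest_tube_proper yt neq_yx)) _.
by rewrite [in X in (_ < X)%N](cardsD1 x) mem_smallest_tube.
Qed.

Lemma node_weight_unique f f' :
  is_node_weight U f -> is_node_weight U f' -> f = f'.
Proof.
move=> wf wf'; apply/ffunP => x.
have [k] := ubnP #|st x|; elim: k x => // k IH x; rewrite ltnS => xk.
have := wf x; have := wf' x; case: ifP => [_ -> ->//|_] /=.
rewrite (sum_setD1 f (mem_smallest_tube U x)) (sum_setD1 f' (mem_smallest_tube U x)) => <-.
rewrite [X in _ + X](eq_bigr f') => [/addIr//|y /[!inE]/andP[neq_yx yt]].
by apply: IH; apply: leq_trans xk; exact: card_smallest_tube_lt.
Qed.

Lemma node_weight_exists : exists f, is_node_weight U f.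
Proof.
pose W f x := if [set x] \in U then f x = 0
  else \sum_(y in st x) f y = 3 ^+ (#|st x| - 2).
suff [f Wf] : exists f, forall x, (#|st x| <= #|V|)%N -> W f x.
  by exists f => x; apply: Wf; exact: max_card.
elim: #|V| => [|k [f Wf]].
  exists [ffun=> 0] => x; rewrite leqn0 cards_eq0 => /eqP t0.
  by have := mem_smallest_tube U x; rewrite -/st t0 inE.
(* Weights are solved for by increasing size of the smallest tube: the other nodes of [st x] have
   strictly smaller smallest tubes, so their weights are already fixed. *)
pose f' := [ffun x => if #|st x| == k.+1 then
  (if [set x] \in U then 0
   else 3 ^+ (#|st x| - 2) - \sum_(y in st x :\ x) f y) else f x].
have ff' x : (#|st x| <= k)%N -> f' x = f x.
  by move=> xk; rewrite ffunE ltn_eqF.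
exists f' => x; rewrite leq_eqVlt ltnS => /orP[/eqP xk|xk].
  have f'x : f' x = if [set x] \in U then 0
      else 3 ^+ (#|st x| - 2) - \sum_(y in st x :\ x) f y.
    by rewrite ffunE xk eqxx.
  rewrite /W; case: ifP => xU; first by rewrite f'x xU.
  rewrite (sum_setD1 f' (mem_smallest_tube U x)) f'x xU.
  rewrite [X in _ + X](eq_bigr f) ?subrK // => y /[!inE]/andP[neq_yx yt].
  by apply: ff'; rewrite -ltnS -xk card_smallest_tube_lt.
rewrite /W; have := Wf x xk; rewrite /W ff' //; case: ifP => // _ <-.
apply: eq_bigr => y yt; apply: ff'; apply: leq_trans xk.
by apply/subset_leq_card/smallest_tube_sub => //; exact: smallest_tube_in.
Qed.

(** The case distinction gives singletons weight 0, where truncated subtraction alone would give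
    1. *)
Definition tube_weight k : nat := if (k <= 1)%N then 0%N else (3 ^ (k - 2))%N.

Lemma tube_weightD j k :
  (tube_weight j + tube_weight k <= tube_weight (j + k))%N.
Proof.
rewrite /tube_weight; case: j => [|[|j]]; case: k => [|[|k]] //=;
  rewrite ?addn0 // ?add1n ?addn1 //= ?subSS ?subn0 ?leq_exp2l //.
(* With both sizes at least 2, the claim is [p + q <= 9 * p * q] for powers [p], [q] of 3. *)
rewrite -[X in (_ <= 3 ^ X)%N]/(j + k.+2)%N !addnS 2!expnS expnD.
have : (0 < 3 ^ j)%N by rewrite expn_gt0.
have : (0 < 3 ^ k)%N by rewrite expn_gt0.
by move: (3 ^ j)%N (3 ^ k)%N => p q; nia.
Qed.

Lemma leq_tube_weight j k : (j <= k)%N -> (tube_weight j <= tube_weight k)%N.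
Proof.
by move/subnKC<-; apply: leq_trans (tube_weightD _ _); rewrite leq_addr.
Qed.

(** The base 3 matters here: powers of 2 would give equality from [k = 3] on. *)
Lemma tube_weight_pred k : (1 < k)%N -> (2 * tube_weight k.-1 < tube_weight k)%N.
Proof.
case: k => [|[|[|k]]] // _; rewrite /tube_weight /= !subSS !subn0 expnS.
by have : (0 < 3 ^ k)%N; [rewrite expn_gt0|lia].
Qed.

Variables (f : {ffun V -> int}) (wf : is_node_weight U f).

Lemma node_weight_setT (x0 : V) : \sum_y f y = 3 ^+ (#|V| - 2).
Proof.
have [x tx] := tubing_uncovered x0 tU; have := wf x; case: ifP => [xU _|_].
  by have := smallest_tube_setT tU tx xU; rewrite set11.
by rewrite tx cardsT => <-; apply: eq_bigl => y; rewrite inE.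
Qed.

(** On a one-node graph the full set has sum 1 but [tube_weight] 0; with more nodes, a one-node
    smallest tube belongs to [U]. *)
Lemma node_weight_smallest_tube x : (1 < #|V|)%N ->
  \sum_(y in st x) f y = (tube_weight #|st x|)%:Z.
Proof.
move=> V_gt1; have := wf x; case: ifP => [xU fx|xU ->].
  suff -> : st x = [set x] by rewrite big_set1 cards1.
  apply/eqP; rewrite eqEsubset sub1set mem_smallest_tube andbT.
  by apply: smallest_tube_sub; rewrite ?in_setU1 ?xU ?orbT ?set11.
rewrite /tube_weight; case: leqP => [t_le1|_]; last by rewrite -natrX natz.
have t1 : [set x] = st x.
  by apply/eqP; rewrite eqEcard sub1set mem_smallest_tube cards1.
have := smallest_tube_in U x; rewrite -/st -t1 in_setU1 xU orbF => /eqP x1.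
by rewrite -cardsT -x1 cards1 in V_gt1.
Qed.

(* Peel off the largest smallest_tube in S and use superadditivity. *)
Lemma node_weight_closed (S : {set V}) : (1 < #|V|)%N ->
  {in S, forall x, st x \subset S} -> \sum_(y in S) f y <= (tube_weight #|S|)%:Z.
Proof.
move=> V_gt1; have [k] := ubnP #|S|; elim: k S => // k IH S Sk clS.
have [->|[x0 x0S]] := set_0Vmem S; first by rewrite big_set0 cards0.
case: (arg_maxnP (fun x => #|st x|) x0S) => x xS max_x.
have tS : st x \subset S by exact: clS.
have SD : S :&: st x = st x by apply/setIidPr.
rewrite (big_setID (st x)) /= SD -(cardsID (st x) S) SD.
rewrite node_weight_smallest_tube //.
apply: le_trans (_ : (tube_weight #|st x| + tube_weight #|S :\: st x|)%N%:Z <= _); last first.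
  exact: tube_weightD.
rewrite PoszD lerD2l; apply: IH.
  apply: leq_trans (_ : #|S| <= k)%N; last exact: Sk.
  rewrite -[X in (_ < X)%N](cardsID (st x) S) SD -add1n leq_add2r.
  by apply/card_gt0P; exists x; exact: mem_smallest_tube.
move=> y /setDP[yS yt]; apply/subsetP => z zt; rewrite in_setD (subsetP (clS _ yS)) // andbT.
apply/negP => zx; case/negP: yt.
have le_yx : (#|st y| <= #|st x|)%N by exact: max_x.
case/orP: (smallest_tubes_nested tU zt zx) => [tyx|txy].
  exact: (subsetP tyx) (mem_smallest_tube _ _).
suff -> : st x = st y by exact: mem_smallest_tube.
by apply/eqP; rewrite eqEcard txy.
Qed.

(** The rest of [st x] contains the smallest tubes of its nodes, so it sums to at most the weight of
    one node fewer, which is less than half the total. *)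
Lemma node_weight_gt x : (1 < #|st x|)%N ->
  (tube_weight #|st x|.-1)%:Z < f x.
Proof.
move=> t_gt1; have V_gt1 := leq_trans t_gt1 (max_card _).
have := node_weight_smallest_tube x V_gt1.
rewrite (sum_setD1 f (mem_smallest_tube U x)).
have /(node_weight_closed V_gt1) : {in st x :\ x, forall y, st y \subset st x :\ x}.
  by move=> y /setD1P[neq_yx yt]; exact: smallest_tube_proper.
rewrite (_ : #|st x :\ x| = #|st x|.-1); last first.
  by rewrite [#|st x|](cardsD1 x) mem_smallest_tube.
have := tube_weight_pred t_gt1.
by move: (tube_weight _) (tube_weight _) (\sum_(y in _) _) (f x) => p q r s; lia.
Qed.

Lemma node_weight_ge0 x : (1 < #|V|)%N -> 0 <= f x.
Proof.
move=> V_gt1; have [t_le1|/node_weight_gt/ltW] := leqP #|st x| 1; last exact: le_trans.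
have := node_weight_smallest_tube x V_gt1.
have -> : st x = [set x].
  by apply/esym/eqP; rewrite eqEcard sub1set mem_smallest_tube cards1.
by rewrite big_set1 cards1 => ->.
Qed.

Lemma tube_card_gt1 u : tube adj u -> (1 < #|V|)%N.
Proof.
case/and3P => u0 u1 _; rewrite -cardsT; apply: leq_ltn_trans (_ : #|u| < _)%N.
  by rewrite card_gt0.
by rewrite proper_card // properT.
Qed.

Lemma node_weight_tube u : u \in U -> \sum_(y in u) f y = (tube_weight #|u|)%:Z.
Proof.
move=> uU; have V_gt1 := tube_card_gt1 (tubing_tube tU uU).
have /card_gt0P[x0 _] := ltnW V_gt1.
have [|x <-] := @smallest_tube_onto U u x0 tU; first by rewrite in_setU1 uU orbT.
exact: node_weight_smallest_tube.
Qed.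

(** A node of least depth in [u] has a smallest tube strictly larger than [u]; its weight alone
    exceeds the bound, and the others are nonnegative. *)
Lemma node_weight_nontube u : tube adj u -> u \notin U ->
  (tube_weight #|u|)%:Z < \sum_(y in u) f y.
Proof.
move=> tu uU; have V_gt1 := tube_card_gt1 tu.
have /and3P[/set0Pn[x0 x0u] u1 cu] := tu.
case: (arg_minnP (depth U) x0u) => x xu min_x.
have ut : u \proper st x.
  rewrite properEneq (sub_smallest_tube tU cu xu min_x) andbT.
  apply/eqP => u_def; have := smallest_tube_in U x.
  by rewrite -u_def in_setU1 (negPf u1) (negPf uU).
have lt_ut := proper_card ut.
have t_gt1 : (1 < #|st x|)%N by apply: leq_ltn_trans lt_ut; apply/card_gt0P; exists x.
rewrite (sum_setD1 f xu); apply: ltr_wpDr.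
  by apply: sumr_ge0 => y _; exact: node_weight_ge0.
apply: le_lt_trans (node_weight_gt t_gt1).
by apply: leq_tube_weight; rewrite -ltnS prednK // ltnW.
Qed.

End NodeWeights.

Lemma tubing_subset T U : tubing adj U -> T \subset U -> tubing adj T.
Proof.
move=> tU /subsetP TU; apply/and3P; split.
- by apply/forall_inP => u /TU; exact: tubing_tube.
- apply/forall_inP => u /TU uU; apply/forall_inP => w /TU; exact: tubing_compatible.
- case/and3P: tU => _ _ /implyP cU; apply/implyP => /cU; apply: contra => CT.
  by apply: subset_trans CT _; apply/subsetP.
Qed.

Lemma tubing_set0 : tubing adj set0.
Proof.
have [x0 _|V0] := pickP (predT : pred V).
  by apply: (@tubingI _ x0) => [u|u w|u]; rewrite inE.
apply/and3P; split; try by apply/forall_inP => u; rewrite inE.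
by rewrite (_ : connected_set _ _) //; apply/connectedP => x; have := V0 x.
Qed.

(** * Functions on the nodes as combinations of tube indicators *)

Section Decomposition.
Import GRing.Theory Num.Theory Order.TTheory.
Local Open Scope ring_scope.
Variable R : realFieldType.

(* Subtract from a its minimum over one component of its support. *)
Lemma nonneg_tube_decomposition (a : V -> R) z : (forall x, 0 <= a x) -> a z = 0 ->
  exists T (l : {set V} -> R), [/\ tubing adj T, {in T, forall u, 0 < l u}
    & forall x, a x = \sum_(u in T | x \in u) l u].
Proof.
have [k] := ubnP #|[set x | a x != 0]|; elim: k a => // k IH a; rewrite ltnS.
set S := [set x | _] => Sk a_ge0 az.
have zS : z \notin S by rewrite inE az eqxx.
have [S0|[x0 x0S]] := set_0Vmem S.
  exists set0, (fun=> 0); split => [|u|x]; rewrite ?inE //.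
    exact: tubing_set0.
  rewrite big_pred0 => [|u]; last by rewrite inE.
  by apply/eqP; move/setP/(_ x): S0; rewrite !inE => /negbFE.
pose u := component S x0; have uS : u \subset S := component_sub x0S.
have x0u : x0 \in u by exact: mem_component.
have [y yu min_y] : exists2 y, y \in u & {in u, forall x, a y <= a x}.
  by case: (arg_minP a x0u) => y yu min_y; exists y.
have ay_gt0 : 0 < a y by rewrite lt_def a_ge0; have := subsetP uS y yu; rewrite inE => ->.
pose a' x := a x - (if x \in u then a y else 0).
have a'_ge0 x : 0 <= a' x.
  by rewrite /a'; case: ifP => [/min_y|_]; rewrite ?subr_ge0 ?subr0.
have a'y : a' y = 0 by rewrite /a' yu subrr.
have S'S : [set x | a' x != 0] \subset S :\ y.
  apply/subsetP => x; rewrite !inE => a'x; apply/andP; split.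
    by apply: contra a'x => /eqP->; rewrite a'y.
  apply: contra a'x => /eqP ax; rewrite /a' ax.
  have -> : x \in u = false; last by rewrite subrr.
  by apply/negP => /(subsetP uS); rewrite inE ax eqxx.
have a'z : a' z = 0.
  by apply/eqP; apply: contraNT zS => a'z; have := subsetP S'S z; rewrite !inE a'z => /(_ isT)/andP[].
have [|T [l [tT l_gt0 a'E]]] := IH a' _ a'_ge0 a'z.
  apply: leq_trans Sk; apply: leq_ltn_trans (subset_leq_card S'S) _.
  by rewrite [X in (_ < X)%N](cardsD1 y) (subsetP uS).
(* Positive coefficients force each tube of [T] into the support of [a'], which omits [y]; hence [u]
   is new and compatible with all of them. *)
have T_sub w : w \in T -> w \subset S :\ y.
  move=> wT; apply: subset_trans S'S; apply/subsetP => x xw; rewrite inE a'E.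
  rewrite gt_eqF // (bigD1 w) /= ?wT //; apply: ltr_wpDr (l_gt0 w wT).
  by apply: sumr_ge0 => v /andP[/andP[/l_gt0/ltW]].
have uT : u \notin T by apply/negP => /T_sub/subsetP/(_ y yu); rewrite !inE eqxx.
have comp_u w : w \in T -> compatible adj u w.
  move=> wT; have /and3P[w0 _ cw] := tubing_tube tT wT.
  by apply: compatible_component => //; exact: subset_trans (T_sub w wT) (subD1set _ _).
exists (u |: T), (fun w => if w == u then a y else l w); split.
- apply: (@tubingI _ z) => [w /setU1P[->|]|w w' /setU1P[->|wT] /setU1P[->|w'T]|w /setU1P[->|/T_sub/subsetP wS]].
  + apply/and3P; split; last exact: connected_component.
      by apply/set0Pn; exists x0.
    by apply: contraNneq zS => u1; apply: (subsetP uS); rewrite u1.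
  + exact: tubing_tube tT.
  + by rewrite /compatible /intersecting /adjacent subxx andbF /= setIid;
      apply/nandP; left; apply/set0Pn; exists x0.
  + exact: comp_u.
  + by rewrite compatible_sym comp_u.
  + exact: tubing_compatible tT _ _.
  + by apply: contra zS => /(subsetP uS).
  + by apply: contra zS => /wS; rewrite in_setD1 => /andP[].
- move=> w /setU1P[->|wT]; first by rewrite eqxx.
  by case: eqP => // _; exact: l_gt0.
move=> x; rewrite big_mkcondr (big_setU1 _ uT) /= eqxx -big_mkcondr /=.
rewrite (eq_bigr l) => [|w /andP[wT _]]; first by rewrite -a'E addrC subrK.
by case: eqP wT => // ->; rewrite (negPf uT).
Qed.

Lemma tube_decomposition (a : V -> R) :
  exists m T (l : {set V} -> R), [/\ tubing adj T, {in T, forall u, 0 < l u}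
    & forall x, a x = m + \sum_(u in T | x \in u) l u].
Proof.
have [x0 _|V0] := pickP (predT : pred V); last first.
  exists 0, set0, (fun=> 0); split=> [|u|x]; rewrite ?inE ?tubing_set0 //.
  by have := V0 x.
case: (arg_minP a (isT : predT x0)) => z _ min_z.
have [x||T [l [tT l_gt0 aE]]] := @nonneg_tube_decomposition (fun x => a x - a z) z.
- by rewrite subr_ge0 min_z.
- by rewrite subrr.
by exists (a z), T, l; split=> // x; rewrite -aE addrC subrK.
Qed.

End Decomposition.

(** The system is triangular: at a node whose smallest tube is [t], only [t] and larger sets
    contribute, and those vanish by induction. *)
Lemma tube_indicators_free (M : zmodType) T (c : {set V} -> M) x0 :
  tubing adj T -> (forall x, \sum_(t in setT |: T | x \in t) c t = 0)%R ->
  {in setT |: T, forall t, c t = 0%R}.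
Proof.
move=> tT sum0 t; have [k] := ubnP (#|V| - #|t|).
elim: k t => // k IH t; rewrite ltnS => tk tin.
have [x xt] := smallest_tube_onto x0 tT tin.
have := sum0 x; rewrite (bigD1 t) /=; last by rewrite tin -xt mem_smallest_tube.
rewrite big1 ?GRing.addr0 // => w /andP[/andP[win xw] neq_wt].
apply: IH => //; apply: leq_trans tk.
have /proper_card lt_tw : t \proper w.
  by rewrite properEneq eq_sym neq_wt -xt; exact: smallest_tube_sub.
by rewrite ltn_sub2l // (leq_trans lt_tw) // max_card.
Qed.

End Tubings.

(* Imported only here: classical_sets shadows the finset notations. *)
From mathcomp Require Import boolp classical_sets functions cardinality.
From mathcomp Require Import interval_inference reals convex.
Import Order.TTheory GRing.Theory Num.Theory.
Local Open Scope classical_set_scope.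
Local Open Scope ring_scope.

Lemma convex_hull_halfspace (R : realType) (n : nat) (S : set 'rV[R]_n)
    (a : 'I_n -> R) (b : R) :
  (forall x, S x -> \sum_i a i * x 0 i <= b) ->
  forall x, convex_hull S x -> \sum_i a i * x 0 i <= b.
Proof.
move=> Sb; apply: smallest_sub => //.
move=> x y l; rewrite !inE /= => xb yb.
have -> : \sum_i a i * (conv l x y : 'rV[R]_n) 0 i =
    l%:num * \sum_i a i * x 0 i + (1 - l%:num) * \sum_i a i * y 0 i.
  rewrite !mulr_sumr -big_split /=; apply: eq_bigr => i _.
  by rewrite !mxE mulrDr !mulrA ![_ * a i]mulrC.
have -> : b = l%:num * b + (1 - l%:num) * b by rewrite -mulrDl subrKC mul1r.
by apply: lerD; apply: ler_wpM2l => //; rewrite subr_ge0 le1.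
Qed.

(** * The hull of points with prescribed tube sums *)

Section Realization.
Variables (R : realType) (n : nat) (V : finType) (adj : rel V).
Variables (v : 'I_n -> V) (adj_sym : symmetric adj) (v_bij : bijective v).
Implicit Types (u : {set V}) (T U : {set {set V}}) (x : 'rV[R]_n).

Local Notation maximal := (maximal_tubings adj).
Local Notation full := [set: V]%SET.

Definition tube_sum u x : R := \sum_(i | v i \in u) x 0 i.

Lemma tube_sumE u x : tube_sum u x = \sum_i (v i \in u)%:R * x 0 i.
Proof.
rewrite /tube_sum big_mkcond; apply: eq_bigr => i _.
by case: ifP; rewrite ?mul1r ?mul0r.
Qed.

Lemma tube_sum_lin (d : V -> R) T m (l : {set V} -> R) x :
  (forall y, d y = m + \sum_(u in T | y \in u) l u) ->
  \sum_i d (v i) * x 0 i =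
  m * tube_sum full x + \sum_(u in T) l u * tube_sum u x.
Proof.
move=> dE; rewrite tube_sumE mulr_sumr.
under [X in _ + X]eq_bigr do rewrite tube_sumE mulr_sumr.
rewrite exchange_big -big_split /=; apply: eq_bigr => i _.
rewrite dE mulrDl finset.in_setT mul1r; congr (_ + _).
rewrite mulr_suml big_mkcondr /=; apply: eq_bigr => u _.
by case: ifP => _; rewrite ?mul1r // mul0r mulr0.
Qed.

Lemma tube_sum_weight_point u (f : {ffun V -> int}) :
  tube_sum u (weight_point R v f) = (\sum_(y in u) f y)%:~R.
Proof.
rewrite (reindex v) /=; last by apply: onW_bij.
by rewrite rmorph_sum; apply: eq_bigr => i _; rewrite mxE.
Qed.

(** The points are abstract: their tube sums attain the bound [g] exactly on the tubes of their own
    tubing. *)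
Variables (c : {set {set V}} -> 'rV[R]_n) (g : {set V} -> R).
Hypothesis c_full : forall U, U \in maximal -> tube_sum full (c U) = g full.
Hypothesis c_tube : forall U u, U \in maximal -> u \in U -> tube_sum u (c U) = g u.
Hypothesis c_nontube : forall U u, U \in maximal -> tube adj u -> u \notin U ->
  g u < tube_sum u (c U).

Local Notation S := [set c U | U in [set` maximal]].
Local Notation P := (convex_hull S).

Lemma hull_vertex U : U \in maximal -> P (c U).
Proof. by move=> mU; apply: sub_gen_smallest; exists U. Qed.

Lemma hull_functional_ge (d : V -> R) b :
  (forall U, U \in maximal -> b <= \sum_i d (v i) * c U 0 i) ->
  forall x, P x -> b <= \sum_i d (v i) * x 0 i.
Proof.
move=> db x Px; rewrite -lerN2 -sumrN.
under eq_bigr do rewrite -mulNr.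
apply: convex_hull_halfspace Px => _ [U mU <-].
by under eq_bigr do rewrite mulNr; rewrite sumrN lerN2 db.
Qed.

Lemma tube_sum_ge u x : tube adj u -> P x -> g u <= tube_sum u x.
Proof.
move=> tu Px; rewrite tube_sumE.
apply: (@hull_functional_ge (fun y => (y \in u)%:R)) Px => U mU.
rewrite -tube_sumE; have [uU|uU] := boolP (u \in U); first by rewrite c_tube.
exact/ltW/c_nontube.
Qed.

Lemma tube_sum_full x : P x -> tube_sum full x = g full.
Proof.
move=> Px; apply/le_anti/andP; split; last first.
  rewrite tube_sumE; apply: (@hull_functional_ge (fun y => (y \in full)%:R)) Px => U mU.
  by rewrite -tube_sumE c_full.
rewrite -lerN2 tube_sumE -sumrN; under eq_bigr do rewrite -mulNr.
apply: (@hull_functional_ge (fun y => - (y \in full)%:R)) Px => U mU.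
by under eq_bigr do rewrite mulNr; rewrite sumrN -tube_sumE c_full.
Qed.

(** * The face poset of the hull *)

Definition tube_face T : set 'rV[R]_n :=
  [set x | P x /\ {in T, forall u, tube_sum u x = g u}].

Lemma tube_face_vertex T U : U \in maximal -> T \subset U -> tube_face T (c U).
Proof.
move=> mU /fintype.subsetP TU; split; first exact: hull_vertex.
by move=> u /TU; exact: c_tube.
Qed.

Lemma tube_face_neq0 T : tubing adj T -> tube_face T !=set0.
Proof.
by case/(tubing_extend adj_sym) => U mU TU; exists (c U); exact: tube_face_vertex.
Qed.

(** The functional minus [b] is a positive combination of the nonnegative slacks
    [tube_sum u x - g u], so it vanishes only when every slack does. *)
Lemma functional_min_face (d : V -> R) T m (l : {set V} -> R) x :
  tubing adj T -> {in T, forall u, 0 < l u} ->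
  (forall y, d y = m + \sum_(u in T | y \in u) l u) -> P x ->
  let b := m * g full + \sum_(u in T) l u * g u in
  b <= \sum_i d (v i) * x 0 i /\
  (\sum_i d (v i) * x 0 i = b <-> tube_face T x).
Proof.
move=> tT l_gt0 dE Px b; rewrite (tube_sum_lin x dE) tube_sum_full //.
have ge0 u : u \in T -> 0 <= l u * tube_sum u x - l u * g u.
  move=> uT; rewrite -mulrBr mulr_ge0 ?subr_ge0 ?(ltW (l_gt0 _ _)) //.
  by apply: tube_sum_ge => //; exact: tubing_tube tT uT.
split; first by rewrite lerD2l -subr_ge0 -sumrB sumr_ge0.
split=> [/addrI/eqP|[_ xT]]; last by congr (_ + _); apply: eq_bigr => u /xT->.
rewrite -subr_eq0 -sumrB => /eqP/(psumr_eq0P ge0) xT; split=> // u uT.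
have /eqP := xT u uT; rewrite -mulrBr mulf_eq0 subr_eq0.
by rewrite gt_eqF ?l_gt0 //= => /eqP.
Qed.

Lemma tube_face_nonempty_face T : tubing adj T -> nonempty_face P (tube_face T).
Proof.
move=> tT; split; last exact: tube_face_neq0.
(* Any positive coefficients would cut out the same face. Signs are reversed below because [face]
   asks for an upper bound. *)
pose d y : R := 0 + \sum_(u in T | y \in u) 1.
have dP x := @functional_min_face d T 0 (fun=> 1) x tT (fun _ _ => ltr01) (fun=> erefl).
exists (\row_i - d (v i)), (- (0 * g full + \sum_(u in T) 1 * g u)).
have aE x : \sum_i (\row_j - d (v j)) 0 i * x 0 i = - \sum_i d (v i) * x 0 i.
  by rewrite -sumrN; apply: eq_bigr => i _; rewrite mxE mulNr.
split=> [x /dP[le_b _]|]; first by rewrite aE lerN2.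
apply/seteqP; split=> [x xT|x [Px /eqP]].
  have Px := xT.1; split=> //; rewrite aE; congr (- _).
  by apply/(dP x Px).2.
by rewrite aE eqr_opp => /eqP /(dP x Px).2.
Qed.

Lemma nonempty_face_tube_face F : nonempty_face P F ->
  exists2 T, tubing adj T & tube_face T = F.
Proof.
case=> -[a [b [Pb ->]]] [x0 [Px0 x0b]].
have [v' vK v'K] := v_bij; pose d y := - a 0 (v' y).
have [m [T [l [tT l_gt0 dE]]]] := tube_decomposition adj_sym d.
have dP x := @functional_min_face d T m l x tT l_gt0 dE.
have aE x : \sum_i d (v i) * x 0 i = - \sum_i a 0 i * x 0 i.
  by rewrite -sumrN; apply: eq_bigr => i _; rewrite /d vK mulNr.
exists T => //; have [y yT] := tube_face_neq0 tT.
set b' := m * _ + _ in dP.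
(* The bound is attained on both sides: [b] at [x0], and [b'] at the point [y] of the tube face. *)
have b'E : b' = - b.
  apply/le_anti/andP; split; first by rewrite -x0b -aE; exact: (dP _ Px0).1.
  rewrite -(iffRL (dP _ yT.1).2 yT) aE lerN2; exact: Pb yT.1.
apply/seteqP; split=> [x xT|x [Px xb]].
  split; first exact: xT.1.
  by apply: oppr_inj; rewrite -aE -b'E; apply/(dP x xT.1).2.
by apply/(dP x Px).2; rewrite aE b'E xb.
Qed.

(** For a tube [u] of [T'] outside [T], a maximal tubing containing [T] and avoiding [u] gives a
    vertex of the first face off the second. *)
Lemma tube_face_sub T T' : tubing adj T -> tubing adj T' ->
  tube_face T `<=` tube_face T' <-> T' \subset T.
Proof.
move=> tT tT'; split=> [sub|/fintype.subsetP T'T x [Px xT]]; last first.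
  by split=> // u /T'T; exact: xT.
apply/fintype.subsetP => u uT'; apply/negPn/negP => uT.
have tu := tubing_tube tT' uT'.
have [|U [mU TU uU]] := tubing_extend_avoid adj_sym (u := u) tT.
  by rewrite finset.in_setU1 negb_or uT andbT; case/and3P: tu.
have [_ /(_ u uT') cu] := sub _ (tube_face_vertex mU TU).
by have := c_nontube mU tu uU; rewrite cu ltxx.
Qed.

Lemma tube_face_inj T T' : tubing adj T -> tubing adj T' ->
  tube_face T = tube_face T' -> T = T'.
Proof.
move=> tT tT' eqF; apply/eqP; rewrite finset.eqEsubset; apply/andP.
by split; apply/tube_face_sub => //; rewrite eqF.
Qed.

(** * Dimensions of the faces *)

Lemma card_V : #|V| = n.
Proof. by rewrite -(bij_eq_card v_bij) card_ord. Qed.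

Lemma tube_sumB u x y : tube_sum u (x - y) = tube_sum u x - tube_sum u y.
Proof. by rewrite /tube_sum -sumrB; apply: eq_bigr => i _; rewrite !mxE. Qed.

Lemma tube_sum_mulmx u k (w : 'rV[R]_k) (A : 'M[R]_(k, n)) :
  tube_sum u (w *m A) = \sum_j w 0 j * tube_sum u (row j A).
Proof.
rewrite /tube_sum; under [RHS]eq_bigr do rewrite mulr_sumr.
rewrite exchange_big /=; apply: eq_bigr => i _; rewrite mxE.
by apply: eq_bigr => j _; rewrite mxE.
Qed.

(* Pairing c (W i) - c U with the indicators of the tubes u j gives a diagonal
   matrix with positive diagonal. *)
Lemma affinely_independent_flips U k (u : 'I_k -> {set V}) (W : 'I_k -> {set {set V}}) :
  injective u -> U \in maximal ->
  (forall i, [/\ u i \in U, W i \in maximal, U :\ u i \subset W i & u i \notin W i]) ->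
  affinely_independent (fun j => c (if unlift ord0 j is Some i then W i else U)).
Proof.
move=> u_inj mU flip; apply: inj_row_free => w w0; apply/rowP => i; rewrite mxE.
have := congr1 (tube_sum (u i)) w0; rewrite tube_sum_mulmx (bigD1 i) //=.
rewrite big1 ?addr0 => [|j neq_ji].
  rewrite rowK liftK unlift_none tube_sumB.
  have [uU mW _ uW] := flip i.
  rewrite (c_tube mU uU) [RHS]/tube_sum big1 => [/eqP|? _]; last by rewrite mxE.
  rewrite mulf_eq0 subr_eq0 => /orP[/eqP //|].
  by rewrite gt_eqF // c_nontube //; exact: tubing_tube (maximal_tubing mU) uU.
rewrite rowK liftK unlift_none tube_sumB; have [_ mW /fintype.subsetP UW _] := flip j.
have [uU _ _ _] := flip i.
rewrite !c_tube ?subrr ?mulr0 //; apply: UW.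
by rewrite in_setD1 uU andbT (inj_eq u_inj) eq_sym.
Qed.

Lemma tube_indicators_row_free T (x0 : V) : tubing adj T ->
  row_free (\matrix_(j < #|full |: T|, i < n) (v i \in enum_val j)%:R : 'M[R]_(_, n)).
Proof.
move=> tT; set Q := full |: T; set B := \matrix_(_, _) _.
have [v' _ v'K] := v_bij; apply: inj_row_free => w w0; apply/rowP => j; rewrite mxE.
(* Carries the coefficients from row indices to sets; [enum_rank_in] needs a proof of membership,
   hence the match. *)
pose l t := if t \in Q =P true is ReflectT tQ then w 0 (enum_rank_in tQ t) else 0.
have lE i : l (enum_val i) = w 0 i.
  by rewrite /l; case: eqP => [tQ|]; [rewrite enum_valK_in|rewrite enum_valP].
rewrite -lE; apply: (tube_indicators_free adj_sym x0 tT) (enum_valP j) => x.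
rewrite big_mkcondr big_enum_val /=.
have /rowP/(_ (v' x)) := w0; rewrite !mxE => w0x; apply: etrans w0x.
apply: eq_bigr => i _.
by rewrite mxE lE v'K; case: ifP; rewrite ?mulr1 ?mulr0.
Qed.

(** From below, take a vertex of the face and replace its tubing by one dropping a single tube
    outside [T], for each such tube. From above, differences of points of the face are killed by the
    independent indicators of [T] and the full set. *)
Lemma has_dim_tube_face T : tubing adj T ->
  has_dim (tube_face T) (#|V|.-1 - #|T|)%N.
Proof.
move=> tT; have [U mU TU] := tubing_extend adj_sym tT.
have <- : #|U :\: T| = (#|V|.-1 - #|T|)%N.
  by rewrite cardsDS // (card_maximal mU).
have tU := maximal_tubing mU; split.
  pose u (i : 'I_#|U :\: T|) := enum_val i.
  have uUT i : u i \in U :\: T by exact: enum_valP.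
  have uU i : u i \in U by have /setDP[] := uUT i.
  have /choice[W WP] i : exists W, [/\ W \in maximal, U :\ u i \subset W & u i \notin W].
    apply: (tubing_extend_avoid adj_sym).
      exact: tubing_subset tU (subD1set _ _).
    rewrite finset.in_setU1 setD11 orbF.
    by case/and3P: (tubing_tube tU (uU i)).
  exists (fun j => c (if unlift ord0 j is Some i then W i else U)); split.
    move=> j; case: unliftP => [i _|_]; last exact: tube_face_vertex.
    have [mW UW _] := WP i; apply: tube_face_vertex => //.
    apply: fintype.subset_trans UW; apply/fintype.subsetP => t tT'.
    rewrite in_setD1 (fintype.subsetP TU) // andbT.
    by apply: contraTneq tT' => ->; have /setDP[] := uUT i.
  apply: (@affinely_independent_flips U _ u) => //; first exact: enum_val_inj.
  by move=> i; have [] := WP i; split.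
move=> k p pT; rewrite /affinely_independent; set A := \matrix_(_, _) _.
move/eqP => rkA; have [x0 _|V0] := pickP (predT : pred V); last first.
  have n0 : n = 0%N by rewrite -card_V; apply: eq_card0 => x; have := V0 x.
  by rewrite -rkA (leq_trans (rank_leq_col A)) // n0.
have /eqP rkB := tube_indicators_row_free x0 tT.
set B := \matrix_(_, _) _ in rkB.
have AB0 : A *m B^T = 0.
  apply/matrixP => i j; rewrite !mxE; set t := enum_val j.
  have /setU1P tQ : t \in full |: T by exact: enum_valP.
  have tp i' : tube_sum t (p i') = g t.
    have [Pp pt] := pT i'; case: tQ => [->|/pt //]; exact: tube_sum_full.
  rewrite (eq_bigr (fun s => (v s \in t)%:R * row i A 0 s)) => [|s _]; last first.
    by rewrite !mxE mulrC.
  by rewrite -tube_sumE rowK tube_sumB !tp subrr.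
have := mulmx0_rank_max AB0; rewrite mxrank_tr rkA rkB cardsU1.
rewrite (negPf (setT_notin_tubing tT)) -card_V cardsDS // (card_maximal mU).
rewrite (leq_subRL _ (card_tubing adj_sym tT)) [(#|T| + k)%N]addnC add1n addnS.
by case: #|V|.
Qed.

Lemma has_dim_inj (F : set 'rV[R]_n) d d' : has_dim F d -> has_dim F d' -> d = d'.
Proof.
case=> [[p [Fp indep_p]] le_d] [[p' [Fp' indep_p']] le_d'].
by apply/eqP; rewrite eqn_leq (le_d' d p) // (le_d d' p').
Qed.

(** * Facets, vertices and simplicity *)

Lemma tube_face_set0 : tube_face finset.set0 = P.
Proof.
by apply/seteqP; split=> [x []//|x Px]; split=> // u; rewrite finset.in_set0.
Qed.

Lemma has_dim_hull : has_dim P #|V|.-1.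
Proof.
have := has_dim_tube_face (tubing_set0 adj).
by rewrite tube_face_set0 cards0 subn0.
Qed.

(** Each tube lowers the dimension by one, so codimension one means a single tube. *)
Lemma facetP (F : set 'rV[R]_n) :
  facet P F <-> exists2 u, tubing adj [set u]%SET & F = tube_face [set u]%SET.
Proof.
split=> [[Ff [k [dimF dimP]]]|[u tu ->]]; last first.
  split; first by have [] := tube_face_nonempty_face tu.
  have := card_tubing adj_sym tu; rewrite cards1 => V_gt1.
  exists (#|V|.-1 - 1)%N; split; first by have := has_dim_tube_face tu; rewrite cards1.
  by rewrite subn1 prednK //; exact: has_dim_hull.
have [T tT FE] : exists2 T, tubing adj T & tube_face T = F.
  apply: nonempty_face_tube_face; split=> //.
  by case: dimF => -[p [Fp _]] _; exists (p ord0).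
have := has_dim_inj dimP has_dim_hull.
have := has_dim_inj dimF; rewrite -FE => /(_ _ (has_dim_tube_face tT)) kE kP.
have /cards1P[u Tu] : #|T| == 1%N by have := card_tubing adj_sym tT; lia.
by exists u; rewrite -?Tu.
Qed.

Lemma vertexP w : vertex P w -> exists2 U, U \in maximal & w = c U.
Proof.
move=> vw; have [|T tT Tw] := @nonempty_face_tube_face [set w].
  by split=> //; exists w.
have eq_w U : U \in maximal -> T \subset U -> w = c U.
  by move=> mU TU; have := tube_face_vertex mU TU; rewrite Tw => ->.
have [U mU TU] := tubing_extend adj_sym tT.
by exists U => //; exact: eq_w.
Qed.

Lemma simple_hull : simple_polytope P.
Proof.
split; first by exists S => //; apply: finite_image; exact: finite_finpred.
exists #|V|.-1; split=> [|w /vertexP[U mU ->]]; first exact: has_dim_hull.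
have tU := maximal_tubing mU.
have tubing1 u : u \in U -> tubing adj [set u]%SET.
  by move=> uU; apply: tubing_subset tU _; rewrite finset.sub1set.
pose F (i : 'I_#|U|) := tube_face [set enum_val i]%SET.
(* By strictness off [U], the facets through [c U] are those of the single tubes of [U]. *)
have -> : [set F | facet P F /\ F (c U)] = F @` setT.
  apply/seteqP; split=> [_ [/facetP[u tu ->] [_ cu]]|_ [i _ <-]].
    have uU : u \in U.
      apply/negPn/negP => uU; have := cu u; rewrite finset.in_set1 eqxx => /(_ isT) cuE.
      have := c_nontube mU (tubing_tube tu (set11 u)) uU.
      by rewrite cuE ltxx.
    by exists (enum_rank_in uU u) => //; rewrite /F enum_rankK_in.
  split; first by apply/facetP; exists (enum_val i) => //; apply: tubing1; exact: enum_valP.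
  by apply: tube_face_vertex => //; rewrite finset.sub1set enum_valP.
apply: card_eq_trans (inj_card_eq _) _; last first.
  by rewrite card_eq_sym -(card_maximal mU); exact: card_II.
move=> i j _ _ /tube_face_inj => /(_ (tubing1 _ (enum_valP i)) (tubing1 _ (enum_valP j))).
by move/finset.set1_inj/enum_val_inj.
Qed.

Theorem hull_realizes_graph_associahedron :
  realizes_graph_associahedron adj P.
Proof.
split; first exact: simple_hull.
exists tube_face; split.
- exact: tube_face_nonempty_face.
- exact: nonempty_face_tube_face.
- exact: tube_face_sub.
Qed.

End Realization.

Theorem theorem1 (R : realType) (n : nat) (V : finType) (adj : rel V)
    (v : 'I_n -> V) (adj_sym : symmetric adj) (v_bij : bijective v) :
  (forall U : {set {set V}}, U \in maximal_tubings adj ->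
     exists! f : {ffun V -> int}, is_node_weight U f) /\
  (forall f : {set {set V}} -> {ffun V -> int},
     (forall U, U \in maximal_tubings adj -> is_node_weight U (f U)) ->
     realizes_graph_associahedron adj
       (convex_hull
          [set weight_point R v (f U) | U in [set` maximal_tubings adj]])).
Proof.
split=> [U mU|f wf].
  have [f wf] := node_weight_exists adj_sym mU; exists f; split=> // f'.
  exact: node_weight_unique mU _ _ wf.
(* The full set needs its own value: the sum is 0 without nodes, despite the truncated exponent, and
   1 for one node, where [tube_weight] is 0. *)
pose total : int := if #|V| == 0%N then 0 else 3 ^+ (#|V| - 2).
pose g (u : {set V}) : R :=
  (if u == [set: V]%SET then total else (tube_weight #|u|)%:Z)%:~R.
have gE u : tube adj u -> g u = (tube_weight #|u|)%:Z%:~R.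
  by case/and3P=> _ u1 _; rewrite /g (negPf u1).
apply: (hull_realizes_graph_associahedron adj_sym v_bij (g := g)).
- move=> U mU; rewrite tube_sum_weight_point // /g eqxx /total.
  case: (pickP (predT : pred V)) => [x0 _|V0]; last first.
    by rewrite (eq_card0 V0) big_pred0 // => y; have := V0 y.
  rewrite (_ : #|V| == 0%N = false); last by apply/negbTE/pred0Pn; exists x0.
  rewrite -(node_weight_setT adj_sym mU (wf U mU) x0); congr _%:~R.
  by apply: eq_bigl => y; rewrite finset.in_setT.
- move=> U u mU uU; rewrite tube_sum_weight_point // gE.
    by rewrite (node_weight_tube adj_sym mU (wf U mU) uU).
  exact: tubing_tube (maximal_tubing mU) uU.
- move=> U u mU tu uU; rewrite tube_sum_weight_point // gE // ltr_int.
  exact: (node_weight_nontube adj_sym mU (wf U mU) tu uU).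
Qed.
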